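(* Let $a=\infty$ and suppose that $\mathcal{H}^1(S_\lambda)<\infty$ for all $\lambda\in[0,\infty)$. Let $C>0$ and let $(\gamma_j)\subset\Gamma_C$ be a sequence with $L(\gamma_j)$ uniformly bounded that converges uniformly on $I$ to $\gamma\in\Gamma_C$. Then for each $\delta>0$ there exists a $\lambda\in[0,\infty)$ such that $$\mathcal{H}^1(\gamma(I)\setminus S_\lambda)\le\delta.$$ In particular, $\mathcal{H}^1(\gamma(I)\setminus S)=0$.
   Context: $I=[0,1]$, $\mathcal{C}=[-1,1]^n$. A set is countably $1$-rectifiable if it is a countable union of Lipschitz images of bounded subsets of $\mathbb{R}$. Fixed: $S\subset\mathcal{C}$ countably $1$-rectifiable and Borel measurable and $b:S\to[0,\infty)$ lower semi-continuous; since $a=\infty$, $b$ is extended to $\mathcal{C}$ by $b=\infty$ on $\mathcal{C}\setminus S$. $S_\lambda=\{z\in S\,|\,b(z)\le\lambda\}$. $\Gamma_C$ is the set of Lipschitz paths $\gamma:I\to\mathcal{C}$ with Lipschitz constant at most $C$. $L(\gamma)=\int_I b(\gamma)|\dot\gamma|\,\mathrm{d}\mathcal{L}$ (convention $0\cdot\infty=0$). *)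

(* Defs.v *)
From mathcomp Require Import all_boot all_order all_algebra.
From mathcomp Require Import all_classical all_reals all_analysis.

Set Implicit Arguments.
Unset Strict Implicit.
Unset Printing Implicit Defensive.

Import Order.TTheory GRing.Theory Num.Theory.
Import numFieldNormedType.Exports.

Local Open Scope classical_set_scope.
Local Open Scope ring_scope.

Section Definitions.
Context {R : realType} {n : nat}.
Local Notation V := 'rV[R]_n.

(* The library norm on matrices is the sup norm; lengths, Lipschitz constants
   and diameters are Euclidean here.  The two norms induce the same topology
   and uniformity, so those are taken from the library. *)
Definition enorm (v : V) : R := Num.sqrt (\sum_(i < n) v ord0 i ^+ 2).

Definition elipschitz (C : R) (A : set R) (f : R -> V) :=
  forall s t, A s -> A t -> enorm (f s - f t) <= C * `|s - t|.

(* The maximum with 0 only serves to give the empty set diameter 0. *)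
Definition diameter (U : set V) : \bar R :=
  maxe 0%E (ereal_sup [set (enorm (p.1 - p.2))%:E | p in U `*` U]).

Definition hausdorff1_pre (d : R) (A : set V) : \bar R :=
  ereal_inf [set (\sum_(k <oo) diameter (U k))%E | U in
    [set U : (set V)^nat | A `<=` \bigcup_k U k /\
                           forall k, (diameter (U k) <= d%:E)%E]].

(* One-dimensional Hausdorff (outer) measure.  The normalising constant is 1,
   so that a segment has its length as measure. *)
Definition hausdorff1 (A : set V) : \bar R :=
  ereal_sup [set hausdorff1_pre d A | d in [set d : R | 0 < d]].

(* Finite unions, and the empty one, are covered because E k may be empty. *)
Definition countably_1_rectifiable (A : set V) :=
  exists (E : (set R)^nat) (f : nat -> R -> V),
    (forall k, bounded_set (E k) /\ exists C : R, elipschitz C (E k) (f k)) /\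
    A = \bigcup_k (f k @` E k).

Definition borel_set (A : set V) := <<s (@open V) >> A.

Definition cube : set V := [set z | forall i, -1 <= z ord0 i <= 1].

(* Lower semicontinuity for the topology induced on S; b is irrelevant
   outside S. *)
Definition lsc_on (S : set V) (b : V -> R) :=
  lower_semicontinuous (fun z : subspace S => (b z)%:E).

Definition extend_weight (a : \bar R) (S : set V) (b : V -> R) (z : V) :
  \bar R := if z \in S then (b z)%:E else a.

Definition sublevel (S : set V) (b : V -> R) (l : R) : set V :=
  [set z | S z /\ b z <= l].

Definition unitI : set R := `[0, 1]%classic.

(* A path on I is represented by a map on R of which only the restriction to I
   matters. *)
Definition lipschitz_paths (C : R) : set (R -> V) :=
  [set g | (forall t, unitI t -> cube (g t)) /\ elipschitz C unitI g].

(* In \bar R, 0 * +oo = 0.  The derivative at interior points of I depends only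
   on the path on I, and exists almost everywhere for Lipschitz paths. *)
Definition path_cost (beta : V -> \bar R) (g : R -> V) : \bar R :=
  (\int[lebesgue_measure]_(t in unitI) (beta (g t) * (enorm (derive1 g t))%:E))%E.

End Definitions.

(* Main.v *)
Require Import Defs.
From HB Require Import structures.
From mathcomp Require Import all_boot all_order all_algebra.
From mathcomp Require Import all_classical all_reals all_analysis.
From mathcomp Require Import measurable_realfun.
From mathcomp Require Import ring lra.

(** The weight is at least l on the part of a path that lies outside the
sublevel set S_l, so a cost of at most M leaves that part a length of at most
M / l, and its image a one-dimensional measure of the same order.  If S_l were
closed, a semicontinuity argument on the open complement of S_l would carry
this bound to the limit path.  But b is lower semicontinuous on S only, and S
is merely Borel, so S_l need not be closed.  This is where its finite measure
enters: a Borel set of finite measure contains a closed set K that misses only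
a part of measure 1 / l.  Then every gamma_j(I) \ K has measure at most
m = ((n + 1) |M| + 1) / l, and K is closed, so gamma(I) \ K has measure at most
a multiple of m, which is small for large l.  Multiplicative constants do not
matter, and three facts carry the argument.

Inner regularity ([hausdorff1_inner_regular]).  One-dimensional Hausdorff
measure is additive on sets at positive distance, which makes closed sets, and
hence Borel sets, Caratheodory measurable ([closed_caratheodory]); a finite
outer measure with this property is regular ([borel_closed_open_approx]).

Semicontinuity ([hausdorff1_limit_path_le]), a weak form of Golab's theorem.
Choose disjoint balls of radius r away from K, centred on the limit path and
as many as possible.  A path close to the limit comes near the centre of each
ball and also leaves the ball, so its image inside the ball has measure at
least r / 4.  Hence there are at most 4 m / r balls, and by maximality the
balls of radius 2 r cover the part of the limit path far from K.

Length ([hausdorff1_image_le_path_cost]).  For a Lipschitz path g, the measure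
of g(A) is at most a constant times the integral over A of the norm of the
derivative of g.  A coordinate f of g becomes nondecreasing when C t is added,
and its Stieltjes measure is absolutely continuous; the Radon-Nikodym density
is the derivative almost everywhere, by Lebesgue's differentiation theorem
([lipschitz_density]).  So increments of g are controlled by the measure with
density the sum of the moduli of the derivatives of the coordinates, and
covering A by intervals transfers this to the image
([hausdorff1_image_le_measure]). *)

Set Implicit Arguments.
Unset Strict Implicit.
Unset Printing Implicit Defensive.

Import Order.TTheory GRing.Theory Num.Theory.
Import numFieldNormedType.Exports.

Local Open Scope classical_set_scope.
Local Open Scope ring_scope.

(** * Euclidean norm and Hausdorff measure *)

Section enorm.
Context {R : realType} {n : nat}.
Implicit Types v : 'rV[R]_n.

Lemma enorm_ge0 v : 0 <= enorm v.
Proof. exact: sqrtr_ge0. Qed.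

Lemma coord_le_enorm v i : `|v ord0 i| <= enorm v.
Proof.
rewrite -sqrtr_sqr /enorm ler_sqrt; last by apply: sumr_ge0 => j _; exact: sqr_ge0.
rewrite (bigD1 i)//= lerDl; apply: sumr_ge0 => j _; exact: sqr_ge0.
Qed.

Lemma coord_le_norm v i : `|v ord0 i| <= `|v|.
Proof.
rewrite [leRHS]/Num.norm/= mx_normrE.
exact: (le_bigmax _ (fun i : 'I_1 * 'I_n => `|v i.1 i.2|) (ord0, i)).
Qed.

Lemma norm_le_enorm v : `|v| <= enorm v.
Proof.
rewrite [leLHS]/Num.norm/= mx_normrE; apply/bigmax_leP; split => /=.
  exact: enorm_ge0.
by case=> i j _ /=; rewrite (ord1 i); exact: coord_le_enorm.
Qed.

Lemma enorm_le_sum v : enorm v <= \sum_(i < n) `|v ord0 i|.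
Proof.
set s := leRHS; have s0 : 0 <= s by exact: sumr_ge0.
rewrite -[s]ger0_norm// -sqrtr_sqr /enorm ler_sqrt ?sqr_ge0//.
rewrite (expr2 s) {1}/s mulr_suml; apply: ler_sum => i _.
rewrite -real_normK ?num_real// expr2 ler_wpM2l//.
by rewrite /s (bigD1 i)//= lerDl sumr_ge0.
Qed.

Lemma enorm_le_norm v : enorm v <= n%:R * `|v|.
Proof.
apply: (le_trans (enorm_le_sum v)).
rewrite mulr_natl -[X in _ *+ X]card_ord -sumr_const.
by apply: ler_sum => i _; exact: coord_le_norm.
Qed.

Lemma enorm0 : enorm (0 : 'rV[R]_n) = 0.
Proof.
by apply/eqP; rewrite eq_le enorm_ge0 andbT (le_trans (enorm_le_norm _))// normr0 mulr0.
Qed.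

End enorm.

Section hausdorff1_outer.
Context {R : realType} {n : nat}.
Local Notation V := 'rV[R]_n.
Implicit Types A B U : set V.
Local Open Scope ereal_scope.

Lemma diameter_ge0 U : 0 <= diameter U.
Proof. by rewrite /diameter le_max lexx. Qed.

Lemma diameter_le U (d : \bar R) : 0 <= d ->
  (forall x y, U x -> U y -> (enorm (x - y))%:E <= d) -> diameter U <= d.
Proof.
move=> d0 Ud; rewrite /diameter ge_max d0 /=.
by apply: ge_ereal_sup => _ [[x y] /= [Ux Uy] <-]; exact: Ud.
Qed.

Lemma enorm_le_diameter U x y : U x -> U y -> (enorm (x - y))%:E <= diameter U.
Proof.
move=> Ux Uy; rewrite /diameter le_max; apply/orP; right.
by apply: ereal_sup_ubound; exists (x, y).
Qed.

Lemma diameter0 : diameter (set0 : set V) = 0.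
Proof. by apply/eqP; rewrite eq_le diameter_ge0 diameter_le. Qed.

Let discrete := g_sigma_algebraType [set: set V].

Let content (d : R) (U : set discrete) : \bar R :=
  if diameter (U : set V) <= d%:E then diameter (U : set V) else +oo.

Let content_ge0 d U : 0 <= content d U.
Proof. by rewrite /content; case: ifP => // _; exact: diameter_ge0. Qed.

(** Giving infinite weight to the sets that are too large turns the constraint
on the covers into part of the weight, so that the theory of outer measures
induced by a weight on all subsets applies. *)
Let hausdorff1_preE (d : R) A :
  hausdorff1_pre d A = mu_ext (content d) (A : set discrete).
Proof.
apply/eqP; rewrite eq_le; apply/andP; split.
  apply: le_ereal_inf_tmp => _ [U [_ AU] <-].
  have [Ud|] := pselect (forall k, diameter (U k : set V) <= d%:E).
    apply: ereal_inf_lbound; exists U => //=.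
    by apply: eq_eseriesr => k _; rewrite /content Ud.
  move=> /existsNP[k /negP Uk].
  rewrite (eseries_pinfty _ (k := k)) ?leey//.
    by move=> j _; rewrite gt_eqF// (lt_le_trans _ (content_ge0 _ _)) ?ltNy0.
  by rewrite /content (negbTE Uk).
apply: le_ereal_inf_tmp => _ [U [AU Ud] <-].
apply: ereal_inf_lbound; exists U => /=.
  by split => // k; exact: sub_sigma_algebra.
by apply: eq_eseriesr => k _; rewrite /content Ud.
Qed.

Lemma hausdorff1_pre_ge0 d A : 0 <= hausdorff1_pre d A.
Proof. by rewrite hausdorff1_preE; exact: mu_ext_ge0. Qed.

Lemma le_hausdorff1_pre d A B : A `<=` B ->
  hausdorff1_pre d A <= hausdorff1_pre d B.
Proof. by rewrite !hausdorff1_preE => AB; exact: le_mu_ext. Qed.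

Lemma hausdorff1_pre_sigma_subadditive d :
  sigma_subadditive (hausdorff1_pre d : set V -> \bar R).
Proof.
move=> F; rewrite hausdorff1_preE.
under eq_eseriesr do rewrite hausdorff1_preE.
exact: (@mu_ext_sigma_subadditive _ discrete R (content d) (content_ge0 d) F).
Qed.

Lemma hausdorff1_pre0 d : (0 <= d)%R -> hausdorff1_pre d (set0 : set V) = 0.
Proof.
move=> d0; apply/eqP; rewrite eq_le hausdorff1_pre_ge0 andbT.
apply: (@le_trans _ _ (\sum_(k <oo) diameter ((fun=> set0 : set V) k))).
  by apply: ereal_inf_lbound; exists (fun=> set0) => //; split => // k;
    rewrite diameter0 lee_fin.
by rewrite eseries0// => i _ _; rewrite diameter0.
Qed.

Lemma hausdorff1_pre_setU d A B : (0 <= d)%R ->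
  hausdorff1_pre d (A `|` B) <= hausdorff1_pre d A + hausdorff1_pre d B.
Proof.
move=> d0; pose F := bigcup2 A B.
rewrite -bigcup2E (le_trans (hausdorff1_pre_sigma_subadditive _ _))//.
rewrite (nneseries_split _ 2); last by move=> *; exact: hausdorff1_pre_ge0.
rewrite add0n big_mkord 2!big_ord_recl big_ord0 adde0 /= eseries0 ?adde0//.
by case=> [|[|i]]//= _ _; exact: hausdorff1_pre0.
Qed.

Lemma hausdorff1_pre_le_diameters d A (U : (set V)^nat) :
  A `<=` \bigcup_k U k -> (forall k, diameter (U k) <= d%:E) ->
  hausdorff1_pre d A <= \sum_(k <oo) diameter (U k).
Proof. by move=> AU Ud; apply: ereal_inf_lbound; exists U. Qed.

Lemma hausdorff1_pre_nincr d e A : (d <= e)%R ->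
  hausdorff1_pre e A <= hausdorff1_pre d A.
Proof.
move=> de; apply: le_ereal_inf_tmp => _ [U [AU Ud] <-].
by apply: hausdorff1_pre_le_diameters => // k; rewrite (le_trans (Ud k))// lee_fin.
Qed.

Lemma hausdorff1_pre_le d A : (0 < d)%R -> hausdorff1_pre d A <= hausdorff1 A.
Proof. by move=> d0; apply: ereal_sup_ubound; exists d. Qed.

Lemma hausdorff1_le A (x : \bar R) :
  (forall d, (0 < d)%R -> hausdorff1_pre d A <= x) -> hausdorff1 A <= x.
Proof. by move=> Ax; apply: ge_ereal_sup => _ [d d0 <-]; exact: Ax. Qed.

Let hausdorff1_0 : hausdorff1 (set0 : set V) = 0.
Proof.
apply/eqP; rewrite eq_le (le_trans _ (hausdorff1_pre_le _ ltr01)) ?hausdorff1_pre_ge0//.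
by rewrite andbT; apply: hausdorff1_le => d d0; rewrite hausdorff1_pre0// ltW.
Qed.

Let hausdorff1_ge0 A : 0 <= hausdorff1 A.
Proof. exact: le_trans (hausdorff1_pre_ge0 1 A) (hausdorff1_pre_le _ ltr01). Qed.

Let le_hausdorff1 : {homo (@hausdorff1 R n) : A B / A `<=` B >-> A <= B}.
Proof.
move=> A B AB; apply: hausdorff1_le => d d0.
exact: le_trans (le_hausdorff1_pre _ AB) (hausdorff1_pre_le _ d0).
Qed.

Let hausdorff1_sigma_subadditive : sigma_subadditive (@hausdorff1 R n).
Proof.
move=> F; apply: hausdorff1_le => d d0.
rewrite (le_trans (hausdorff1_pre_sigma_subadditive _ _))//.
by apply: lee_nneseries => k _; [move=> _; exact: hausdorff1_pre_ge0|
  exact: hausdorff1_pre_le].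
Qed.

HB.instance Definition _ := isOuterMeasure.Build R V (@hausdorff1 R n)
  hausdorff1_0 hausdorff1_ge0 le_hausdorff1 hausdorff1_sigma_subadditive.

Lemma hausdorff1_set1 (x : V) : hausdorff1 [set x] = 0.
Proof.
apply/eqP; rewrite eq_le outer_measure_ge0 andbT; apply: hausdorff1_le => d d0.
have D0 : diameter [set x] = 0.
  apply/eqP; rewrite eq_le diameter_ge0 andbT diameter_le// => _ _ -> ->.
  by rewrite subrr enorm0.
apply: (le_trans (@hausdorff1_pre_le_diameters d _ (fun=> [set x]) _ _)).
- by move=> _ ->; exists 0%N.
- by move=> _; rewrite D0 lee_fin ltW.
- by rewrite eseries0// => i _ _; rewrite D0.
Qed.

(** A set of diameter less than e meets at most one of A and B, so a fine cover
of the union splits into a cover of A and a cover of B. *)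
Lemma hausdorff1_separated (e : R) A B : (0 < e)%R ->
  (forall x y, A x -> B y -> (e <= `|x - y|)%R) ->
  hausdorff1 A + hausdorff1 B <= hausdorff1 (A `|` B).
Proof.
move=> e0 ABe.
(* Each member of a cover is handed to A if it meets A, and to B otherwise. *)
have small (d : R) : (0 < d < e)%R ->
    hausdorff1_pre d A + hausdorff1_pre d B <= hausdorff1_pre d (A `|` B).
  move=> /andP[d0 de]; apply: le_ereal_inf_tmp => _ [U [ABU Ud] <-].
  pose meets k := `[< U k `&` A !=set0 >].
  pose UA k := if meets k then U k else set0.
  pose UB k := if meets k then set0 else U k.
  have -> : \sum_(k <oo) diameter (U k) =
      \sum_(k <oo) diameter (UA k) + \sum_(k <oo) diameter (UB k).
    rewrite -nneseriesD; [|by move=> *; exact: diameter_ge0..].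
    apply: eq_eseriesr => k _; rewrite /UA /UB.
    by case: ifP => _; rewrite diameter0 ?adde0 ?add0e.
  apply: leeD; apply: hausdorff1_pre_le_diameters.
  - move=> x Ax; have [|k _ Ukx] := ABU x; first by left.
    by exists k => //; rewrite /UA ifT//; apply/asboolP; exists x.
  - by move=> k; rewrite /UA; case: ifP => // _; rewrite diameter0 lee_fin ltW.
  - move=> y By; have [|k _ Uky] := ABU y; first by right.
    exists k => //; rewrite /UB ifF//; apply/asboolP => -[x [Ukx Ax]].
    have := le_trans (enorm_le_diameter Ukx Uky) (Ud k).
    rewrite lee_fin leNgt (lt_le_trans de)// (le_trans (ABe _ _ Ax By))//.
    exact: norm_le_enorm.
  - by move=> k; rewrite /UB; case: ifP => // _; rewrite diameter0 lee_fin ltW.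
have main d d' : (0 < d)%R -> (0 < d')%R ->
    hausdorff1_pre d A + hausdorff1_pre d' B <= hausdorff1 (A `|` B).
  move=> d0 d'0; pose m := Num.min (Num.min d d') (e / 2)%R.
  have m0 : (0 < m)%R by rewrite !lt_min d0 d'0 divr_gt0.
  have me : (m < e)%R by rewrite gt_min [X in _ || X]ltr_pdivrMr// ltr_pMr// ltr1n orbT.
  apply: (le_trans _ (hausdorff1_pre_le _ m0)).
  apply: le_trans (small m _); last by rewrite m0 me.
  by apply: leeD; apply: hausdorff1_pre_nincr; rewrite !ge_min lexx ?orbT.
have [->|ABoo] := eqVneq (hausdorff1 (A `|` B)) +oo; first by rewrite leey.
have fin X : X `<=` A `|` B -> hausdorff1 X \is a fin_num.
  move=> XAB; rewrite ge0_fin_numE ?outer_measure_ge0//.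
  by rewrite (le_lt_trans (le_hausdorff1 XAB))// ltey.
rewrite -leeBrDr; last by apply: fin; exact: subsetUr.
apply: hausdorff1_le => d d0; rewrite leeBrDr; last by apply: fin; exact: subsetUr.
have dfin : hausdorff1_pre d A \is a fin_num.
  rewrite ge0_fin_numE ?hausdorff1_pre_ge0// (le_lt_trans (hausdorff1_pre_le _ d0))//.
  by rewrite -ge0_fin_numE ?fin//; exact: subsetUl.
rewrite addeC -leeBrDr//; apply: hausdorff1_le => d' d'0.
by rewrite leeBrDr// addeC; exact: main.
Qed.

End hausdorff1_outer.

(** * Closed sets are measurable for metric outer measures *)

Section away.
Context {R : realType} {V : normedModType R}.
Implicit Types (F : set V) (j k : nat).

(** These sets are closed, lie at positive distance from F, and exhaust the
complement of F when F is closed; all approximations of open sets from inside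
use them. *)
Definition away F k := [set x : V | forall y, F y -> k.+1%:R^-1 <= `|x - y|].

Lemma le_away F j k : (j <= k)%N -> away F j `<=` away F k.
Proof.
move=> jk x xF y Fy; apply: le_trans (xF y Fy).
by rewrite lef_pV2 ?posrE ?ltr0n// ler_nat ltnS.
Qed.

Lemma closed_away F k : closed (away F k).
Proof.
have -> : away F k = \bigcap_(y in F) [set x | k.+1%:R^-1 <= `|x - y|] by [].
apply: closed_bigI => y _.
have -> : [set x | k.+1%:R^-1 <= `|x - y|] =
    (fun x => `|x - y|) @^-1` [set r : R | k.+1%:R^-1 <= r] by [].
apply: closed_comp; last exact: closed_ge.
by move=> x _; apply: cvg_norm; apply: cvgB; [exact: cvg_id|exact: cvg_cst].
Qed.

Lemma bigcup_away F : closed F -> \bigcup_k away F k = ~` F.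
Proof.
move=> cF; apply/seteqP; split => [x [k _ xF] Fx|x Fx].
  by have := xF x Fx; rewrite subrr normr0 leNgt invr_gt0 ltr0n.
have : nbhs x (~` F) by apply: open_nbhs_nbhs; split => //; exact: closed_openC.
move=> /nbhs_ballP[e /= e0 xe].
exists (Num.truncn e^-1) => // y Fy; rewrite leNgt; apply/negP => xy.
apply: (xe y) => //; rewrite -ball_normE /=; apply: (lt_trans xy).
by rewrite -[ltRHS]invrK ltf_pV2 ?posrE ?invr_gt0// truncnS_gt.
Qed.

End away.

Section metric_outer_measure.
Context {R : realType} {V : normedModType R}.
Variable mu : {outer_measure set V -> \bar R}.
Local Open Scope ereal_scope.

Hypothesis mu_separated : forall (e : R) (A B : set V), (0 < e)%R ->
  (forall x y, A x -> B y -> (e <= `|x - y|)%R) ->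
  mu A + mu B <= mu (A `|` B).

Section annuli.
Variables (F X : set V).
Hypothesis cF : closed F.

Let far k := X `&` away F k.
Let ring k := far k.+1 `\` far k.

Let le_far j k : (j <= k)%N -> far j `<=` far k.
Proof. by move=> jk; apply: setIS; exact: le_away. Qed.

(** One skipped annulus keeps the next one at positive distance. *)
Let far_ring k : mu (far k) + mu (ring k.+1) <= mu (far k.+2).
Proof.
have e0 : (0 < k.+1%:R^-1 - k.+2%:R^-1 :> R)%R.
  by rewrite subr_gt0 ltf_pV2 ?posrE ?ltr0n// ltr_nat.
apply: (le_trans (mu_separated e0 _)).
  move=> x y [_ xF] [[Xy _] /not_andP[//|/existsNP[z /not_implyP[Fz]]]].
  move=> /negP; rewrite -ltNge => yz.
  rewrite lerBlDr (le_trans (xF z Fz))// -(subrKA y).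
  by rewrite (le_trans (ler_normD _ _))// lerD2l ltW.
apply: le_outer_measure; rewrite subUset; split.
  exact: (le_far (leqW (leqnSn k))).
exact: subDsetl.
Qed.

(** The annuli of a fixed parity are separated from one another, so they add up
within X. *)
Let sum_rings p N : \sum_(i < N) mu (ring (i.*2.+1 + p)) <= mu X.
Proof.
apply: (@le_trans _ _ (mu (far (N.*2 + p)))); last first.
  by apply: le_outer_measure => x [].
elim: N => [|N IH]; first by rewrite big_ord0 outer_measure_ge0.
rewrite big_ord_recr /= doubleS !addSn (le_trans _ (far_ring _))//.
exact: leeD2r.
Qed.

Let rings_fin : mu X < +oo -> \sum_(0 <= k <oo) mu (ring k.+1) < +oo.
Proof.
move=> Xoo; apply: (@le_lt_trans _ _ (mu X + mu X)); last exact: lte_add_pinfty.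
apply: lime_le; first by apply: is_cvg_nneseries => *; exact: outer_measure_ge0.
apply: nearW => N; rewrite big_mkord.
apply: (@le_trans _ _ (\sum_(i < N.*2) mu (ring i.+1))).
  apply: (@lee_sum_nneg_ord _ (fun i => mu (ring i.+1)) xpredT) => //.
  by rewrite -addnn leq_addr.
have -> : \sum_(i < N.*2) mu (ring i.+1) =
    \sum_(i < N) mu (ring (i.*2.+1 + 0)) + \sum_(i < N) mu (ring (i.*2.+1 + 1)).
  elim: N => [|N IH]; first by rewrite !big_ord0 adde0.
  rewrite doubleS 2!big_ord_recr/= IH !big_ord_recr/= addeACA -!addeA.
  by rewrite addn0 addn1.
by apply: leeD; exact: sum_rings.
Qed.

Let far_cover k : X `\` F `<=` far k `|` \bigcup_i ring (i + k).
Proof.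
move=> x [Xx Fx].
have [m farm] : exists m, far m x.
  by have : (~` F) x by []; rewrite -(bigcup_away cF) => -[m _ mx]; exists m.
have [farkx|farkx] := pselect (far k x); [by left|right].
have [m' farm' minm'] :=
  find_ex_minn (ex_intro (fun m => `[< far m x >]) m (asboolT farm)).
have km : (k < m')%N.
  rewrite ltnNge; apply/negP => m'k; apply: farkx; apply: (le_far m'k).
  exact/asboolP.
have m'E : m' = (m'.-1).+1 by rewrite prednK// (leq_trans _ km).
exists (m'.-1 - k)%N => //; rewrite subnK; last by rewrite -ltnS -m'E.
split; first by rewrite -m'E; exact/asboolP.
by move=> /asboolP/minm'; rewrite {1}m'E ltnn.
Qed.

(** Caratheodory's argument: [far k] is separated from F, and the rest of X \ F
is covered by the annuli beyond k, whose total measure tends to 0 because the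
series of their measures converges. *)
Lemma separated_caratheodory_le : mu (X `&` F) + mu (X `&` ~` F) <= mu X.
Proof.
have [->|Xoo] := eqVneq (mu X) +oo; first by rewrite leey.
have {}Xoo : mu X < +oo by rewrite ltey.
apply/lee_addgt0Pr => e e0.
have tail0 := nneseries_tail_cvg (rings_fin Xoo)
  (fun k _ => outer_measure_ge0 mu (ring k.+1)).
have [k tailk] : exists k, \sum_(k <= i <oo) mu (ring i.+1) < e%:E.
  have : nbhs (0 : \bar R) [set y | y < e%:E].
    by apply: open_nbhs_nbhs; split; [exact: open_ereal_lt_ereal|rewrite /= lte_fin].
  by move=> /tail0[k _ /(_ k (leqnn k)) tailk]; exists k.
have XF : mu (X `&` ~` F) <= mu (far k.+1) + \sum_(k <= i <oo) mu (ring i.+1).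
  rewrite -setDE (le_trans (le_outer_measure mu _ _ (far_cover k.+1)))//.
  rewrite (le_trans (outer_measureU2 _ _ _))// leeD2l//.
  rewrite (le_trans (outer_measure_sigma_subadditive mu _))//.
  rewrite -(@nneseries_addn _ (fun i => mu (ring i.+1)))//.
  by under eq_eseriesr do rewrite addnS.
rewrite (le_trans (leeD2l _ XF))// addeA leeD ?(ltW tailk)//.
have e0' : (0 < k.+2%:R^-1 :> R)%R by rewrite invr_gt0.
apply: le_trans (mu_separated e0' _) _.
  by move=> x y [_ Fx] [_ /(_ x Fx)]; rewrite distrC.
by apply: le_outer_measure => x [[]|[]].
Qed.

End annuli.

Lemma closed_caratheodory F : closed F -> mu.-caratheodory F.
Proof.
by move=> cF; apply: le_caratheodory_measurable => X; exact: separated_caratheodory_le.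
Qed.

End metric_outer_measure.

(** * Regularity of finite Borel outer measures *)

Section borel_regularity.
Context {R : realType} {V : normedModType R}.
Local Open Scope ereal_scope.

Lemma borel_caratheodory (mu : {outer_measure set V -> \bar R}) :
  (forall F, closed F -> mu.-caratheodory F) ->
  forall A, <<s (@open V) >> A -> mu.-caratheodory A.
Proof.
move=> closed_mu; apply: smallest_sub => [|U oU].
  split; first exact: caratheodory_measurable_set0.
    by move=> A; rewrite setTD; exact: caratheodory_measurable_setC.
  exact: caratheodory_measurable_bigcup.
rewrite -[U]setCK; apply: caratheodory_measurable_setC.
by apply: closed_mu; exact: open_closedC.
Qed.

Section finite.
Variable mu : {outer_measure set V -> \bar R}.
Hypothesis mu_fin : mu setT < +oo.
Hypothesis closed_mu : forall F, closed F -> mu.-caratheodory F.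

(** Continuity from above, which is where the finiteness of the measure is
used. *)
Let shrinking_small (G : (set V)^nat) (B : set V) (e : R) : (0 < e)%R ->
  (forall k, <<s (@open V) >> (G k)) -> nonincreasing_seq G ->
  \bigcap_k G k `<=` B -> exists k, mu (G k) <= mu B + e%:E.
Proof.
move=> e0 bG ni GB.
have mG k : mu.-cara.-measurable (G k) by exact: borel_caratheodory.
have mu_lty A : mu A < +oo by rewrite (le_lt_trans _ mu_fin)// le_outer_measure.
have := @nonincreasing_cvg_mu _ (caratheodory_type mu) R mu G (mu_lty _) mG
  (bigcapT_measurable mG) ni.
have muGfin : mu (\bigcap_k G k) \is a fin_num.
  by rewrite ge0_fin_numE ?outer_measure_ge0.
have : nbhs (mu (\bigcap_k G k)) [set y | y < mu (\bigcap_k G k) + e%:E].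
  apply: open_nbhs_nbhs; split; first exact: open_ereal_lt_ereal.
  by rewrite /= lteDl// lte_fin.
move=> /[swap] /[apply] -[k _ /(_ k (leqnn k)) /= Gk]; exists k.
by rewrite (le_trans (ltW Gk))// leeD2r// le_outer_measure.
Qed.

Let approximable A := forall e : R, (0 < e)%R -> exists F U,
  [/\ closed F, open U, F `<=` A, A `<=` U & mu (U `\` F) <= e%:E].

Let open_borel (U : set V) : open U -> <<s (@open V) >> U.
Proof. exact: sub_sigma_algebra. Qed.

Let approximable_open U : open U -> approximable U.
Proof.
move=> oU e e0.
have UE : \bigcup_k away (~` U) k = U.
  by rewrite bigcup_away ?setCK//; exact: open_closedC.
have [|||k Uk] := @shrinking_small (fun k => U `\` away (~` U) k) set0 e e0.
- move=> k; rewrite setDE; apply: open_borel; apply: openI => //.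
  exact/closed_openC/closed_away.
- by move=> j k jk; apply/subsetPset; apply: setDS; exact: le_away.
- by rewrite bigcupDr ?UE ?setDv//; exists 0%N.
exists (away (~` U) k), U; split => //; first exact: closed_away.
  by rewrite -{2}UE; exact: bigcup_sup.
by rewrite (le_trans Uk)// outer_measure0 add0e.
Qed.

Let approximable_setC A : approximable A -> approximable (~` A).
Proof.
move=> aA e e0; have [F [U [cF oU FA AU UF]]] := aA e e0.
exists (~` U), (~` F); split.
- exact: open_closedC.
- exact: closed_openC.
- exact: subsetC.
- exact: subsetC.
- by rewrite setDE setCK setIC -setDE.
Qed.

Let approximable_bigcup (A : (set V)^nat) :
  (forall k, approximable (A k)) -> approximable (\bigcup_k A k).
Proof.
move=> aA e e0; have e20 : (0 < e / 2)%R by rewrite divr_gt0.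
have /choice[FU FUA] k : exists FU : set V * set V, [/\ closed FU.1, open FU.2,
    FU.1 `<=` A k, A k `<=` FU.2 & mu (FU.2 `\` FU.1) <= (e / 2 / (2 ^ k.+1)%:R)%:E].
  have [|F [U ?]] := aA k (e / 2 / (2 ^ k.+1)%:R)%R; last by exists (F, U).
  by rewrite divr_gt0// ltr0n expn_gt0.
pose U := \bigcup_k (FU k).2; pose Fn N := \bigcup_(k in `I_N) (FU k).1.
have oU : open U by apply: bigcup_open => k _; have [] := FUA k.
have cF N : closed (Fn N).
  by apply: closed_bigcup => [|k _]; [exact: finite_II|have [] := FUA k].
have [|||N UN] := @shrinking_small (fun N => U `\` Fn N)
    (\bigcup_k ((FU k).2 `\` (FU k).1)) _ e20.
- by move=> N; apply: open_borel; rewrite setDE; apply: openI => //; exact: closed_openC.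
- move=> j k jk; apply/subsetPset; apply: setDS.
  by apply: bigcup_subset => i /= /leq_trans; apply.
- move=> x Ux; have [[k _ Ukx] _] := Ux 0%N I.
  exists k => //; split => // Fkx; have [_] := Ux k.+1 I; apply.
  by exists k => /=.
exists (Fn N), U; split => //.
- by move=> x [k _ Fkx]; exists k => //; have [_ _ + _ _] := FUA k; exact.
- by move=> x [k _ Akx]; exists k => //; have [_ _ _ + _] := FUA k; exact.
rewrite (le_trans UN)// [e in leRHS]splitr EFinD leeD2r//.
rewrite (le_trans (outer_measure_sigma_subadditive mu _))//.
apply: le_trans (epsilon_trick0 xpredT (ltW e20)).
by apply: lee_nneseries => k _ //; have [] := FUA k.
Qed.

(** The sets squeezed in this way form a sigma-algebra.  It contains the open
sets because these are increasing unions of closed ones; for a countable union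
only finitely many of the closed sets are kept. *)
Lemma borel_closed_open_approx A (e : R) : <<s (@open V) >> A -> (0 < e)%R ->
  exists F U, [/\ closed F, open U, F `<=` A, A `<=` U & mu (U `\` F) <= e%:E].
Proof.
move=> bA; suff aA : approximable A by exact: aA.
move: A bA; apply: smallest_sub; last exact: approximable_open.
split; [|by move=> A; rewrite setTD; exact: approximable_setC|exact: approximable_bigcup].
move=> r r0; exists set0, set0; split => //; [exact: closed0|exact: open0|].
by rewrite setD0 outer_measure0 lee_fin ltW.
Qed.

End finite.
End borel_regularity.

Section restrict_outer.
Context {R : realType} {T : Type}.
Variables (mu : {outer_measure set T -> \bar R}) (D : set T).
Local Open Scope ereal_scope.

(** Restricting to a set of finite measure gives a finite outer measure.  It
keeps the measurable sets, since the Caratheodory condition at X for the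
restriction is the one at X `&` D for mu. *)
Definition restrict_outer (A : set T) := mu (A `&` D).

Let restrict_outer0 : restrict_outer set0 = 0.
Proof. by rewrite /restrict_outer set0I outer_measure0. Qed.

Let restrict_outer_ge0 A : 0 <= restrict_outer A.
Proof. exact: outer_measure_ge0. Qed.

Let le_restrict_outer : {homo restrict_outer : A B / A `<=` B >-> A <= B}.
Proof. by move=> A B AB; apply: le_outer_measure; exact: setSI. Qed.

Let restrict_outer_sigma_subadditive : sigma_subadditive restrict_outer.
Proof.
by move=> F; rewrite /restrict_outer setI_bigcupl; exact: outer_measure_sigma_subadditive.
Qed.

HB.instance Definition _ := isOuterMeasure.Build R T restrict_outer
  restrict_outer0 restrict_outer_ge0 le_restrict_outer restrict_outer_sigma_subadditive.

Lemma restrict_outer_caratheodory A :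
  mu.-caratheodory A -> restrict_outer.-caratheodory A.
Proof.
move=> mA X; rewrite /restrict_outer (mA (X `&` D)).
by congr (mu _ + mu _); exact: setIAC.
Qed.

End restrict_outer.

Section hausdorff1_borel.
Context {R : realType} {n : nat}.
Local Notation V := 'rV[R]_n.
Local Open Scope ereal_scope.

Lemma closed_hausdorff1_caratheodory (F : set V) :
  closed F -> (@hausdorff1 R n).-caratheodory F.
Proof. by apply: closed_caratheodory => e A B; exact: hausdorff1_separated. Qed.

Lemma hausdorff1_inner_regular (A : set V) (e : R) : borel_set A ->
  hausdorff1 A < +oo -> (0 < e)%R ->
  exists K, [/\ closed K, K `<=` A & hausdorff1 (A `\` K) <= e%:E].
Proof.
move=> bA Aoo e0.
have [||K [U [cK _ KA AU UK]]] :=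
    @borel_closed_open_approx _ _ (restrict_outer (@hausdorff1 R n) A) _ _ _ e bA e0.
- by change (hausdorff1 (setT `&` A) < +oo); rewrite setTI.
- move=> F cF; apply: restrict_outer_caratheodory; exact: closed_hausdorff1_caratheodory.
exists K; split => //; apply: le_trans UK; apply: le_outer_measure.
by move=> x [Ax Kx]; split => //; split => //; exact: AU.
Qed.

End hausdorff1_borel.

Section hausdorff1_lower.
Context {R : realType} {n : nat}.
Local Notation V := 'rV[R]_n.
Local Open Scope ereal_scope.

Lemma caratheodory_sum_le (I : Type) (T : Type) (mu : {outer_measure set T -> \bar R})
    (B : I -> set T) (s : seq I) (X : set T) :
  (forall i, mu.-caratheodory (B i)) ->
  pairwise (fun i j => `[< B i `&` B j = set0 >]) s ->
  \sum_(i <- s) mu (X `&` B i) <= mu X.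
Proof.
move=> mB; elim: s X => [|i s IH] X; first by rewrite big_nil outer_measure_ge0.
rewrite pairwise_cons => /andP[Bi ps]; rewrite big_cons (mB i X) leeD2l//.
apply: le_trans (IH _ ps); rewrite le_eqVlt; apply/orP; left; apply/eqP.
elim: s Bi {IH ps} => [|j s IH]; first by rewrite !big_nil.
move=> /= /andP[/asboolP Bij Bi]; rewrite !big_cons IH//; congr (mu _ + _).
rewrite -setIA; congr (_ `&` _); apply/esym/setIidPr => x Bjx Bix.
by have : (B i `&` B j) x by []; rewrite Bij.
Qed.

(** The image under phi of a member U of a cover lies in the interval of radius
diameter U around one of its points; this gives the factor 2. *)
Lemma hausdorff1_ge_lipschitz_image (phi : V -> R) (X : set V) (a b : R) :
  (forall x y, (`|phi x - phi y| <= enorm (x - y))%R) ->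
  `]a, b]%classic `<=` phi @` X -> (b - a)%:E <= 2%:E * hausdorff1 X.
Proof.
move=> phi_lip abX; apply: (@le_trans _ _ (2%:E * hausdorff1_pre 1 X)); last first.
  by rewrite lee_pmul2l// hausdorff1_pre_le.
rewrite -lee_pdivrMl//; apply: le_ereal_inf_tmp => _ [U [XU U1] <-].
rewrite lee_pdivrMl//.
have Ufin k : diameter (U k) \is a fin_num.
  by rewrite ge0_fin_numE ?diameter_ge0// (le_lt_trans (U1 k))// ltry.
have /choice[J JU] k : exists x : R, phi @` U k `<=`
    `[(x - fine (diameter (U k)))%R, (x + fine (diameter (U k)))%R]%classic.
  have [->|/set0P[y Uy]] := eqVneq (U k) set0; first by exists 0%R; rewrite image_set0.
  exists (phi y) => _ [z Uz <-] /=.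
  rewrite in_itv /= -ler_distl (le_trans (phi_lip _ _))// -lee_fin fineK//.
  exact: enorm_le_diameter.
have abJ : `]a, b]%classic `<=`
    \bigcup_k `[(J k - fine (diameter (U k)))%R, (J k + fine (diameter (U k)))%R]%classic.
  by move=> _ /abX[x /XU[k _ Ukx] <-]; exists k => //; apply: JU; exists x.
have [ba|ab] := leP b a.
  rewrite (@le_trans _ _ 0)//; first by rewrite lee_fin subr_le0.
  by rewrite mule_ge0// nneseries_ge0// => k _ _; exact: diameter_ge0.
have mle : lebesgue_measure (`]a, b]%classic : set R) <= \sum_(k <oo) lebesgue_measure
    (`[(J k - fine (diameter (U k)))%R, (J k + fine (diameter (U k)))%R]%classic : set R).
  exact: (measure_sigma_subadditive (@lebesgue_measure R)
    (fun k => measurable_itv `[(J k - fine (diameter (U k)))%R,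
                               (J k + fine (diameter (U k)))%R])
    (measurable_itv `]a, b]) abJ).
apply: le_trans (le_trans mle _); first by rewrite lebesgue_measure_itv /= lte_fin ab.
rewrite -nneseriesZl => [|k _]; last exact: diameter_ge0.
apply: lee_nneseries => [k _ _|k _]; first exact: measure_ge0.
have Dk : (0 <= fine (diameter (U k)))%R by rewrite fine_ge0// diameter_ge0.
rewrite lebesgue_measure_itv /=; case: ifPn => _; last by rewrite mule_ge0// diameter_ge0.
rewrite -EFinB -[in leRHS](fineK (Ufin k)) -EFinM lee_fin; lra.
Qed.

End hausdorff1_lower.

(** * Semicontinuity along converging paths *)

Section golab.
Context {R : realType} {n : nat}.
Local Notation V := 'rV[R]_n.
Local Open Scope ereal_scope.

Local Notation cball x r := [set y : V | (`|y - x| <= r)%R].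

Lemma closed_cball (x : V) (r : R) : closed (cball x r).
Proof.
have -> : cball x r = (fun y => `|y - x|%R) @^-1` [set s : R | (s <= r)%R] by [].
apply: closed_comp; last exact: closed_le.
by move=> y _; exact: (cvg_norm (cvgB (@cvg_id _ (nbhs y)) (cvg_cst x))).
Qed.

(** Along a path that comes within a of x and leaves the ball of radius r, the
distance to x takes all values between a and r. *)
Lemma hausdorff1_path_ball (g : R -> V) (x : V) (a r s t : R) :
  continuous g -> unitI s -> unitI t ->
  (`|g s - x| <= a)%R -> (r <= `|g t - x|)%R ->
  (r - a)%:E <= 2%:E * hausdorff1 (g @` unitI `&` cball x r).
Proof.
move=> cg Is It gs gt.
apply: (@hausdorff1_ge_lipschitz_image _ _ (fun y => `|y - x|%R)) => [y z|rho /=].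
  apply: le_trans (norm_le_enorm _).
  by rewrite (le_trans (ler_dist_dist _ _))// opprB addrA subrK.
rewrite in_itv /= => /andP[arho rhor].
pose f u : R := `|g u - x|%R.
have cf : continuous f.
  by move=> u; exact: (cvg_norm (cvgB (cg u) (cvg_cst x))).
have [u Iu fu] : exists2 u, unitI u & f u = rho.
  have fs : (f s <= rho)%R by rewrite (le_trans gs)// ltW.
  have ft : (rho <= f t)%R by exact: le_trans gt.
  move: Is It; rewrite /unitI /= !in_itv /= => /andP[s0 s1] /andP[t0 t1].
  have [st|ts] := leP s t.
    have [||u] := @IVT R f s t rho st.
    - exact: continuous_subspaceT.
    - by rewrite ge_min fs /= le_max ft orbT.
    rewrite in_itv /= => /andP[su ut] fu; exists u => //.
    by rewrite in_itv /= (le_trans s0)//= (le_trans ut).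
  have [||u] := @IVT R f t s rho (ltW ts).
  - exact: continuous_subspaceT.
  - by rewrite ge_min fs orbT /= le_max ft.
  rewrite in_itv /= => /andP[tu us] fu; exists u => //.
  by rewrite in_itv /= (le_trans t0)//= (le_trans us).
exists (g u) => //; split; first by exists u.
by rewrite /= -/(f u) fu.
Qed.

Section limit.
Variables (g_ : nat -> R -> V) (g : R -> V) (K : set V) (m : R).
Hypothesis cg_ : forall j, continuous (g_ j).
Hypothesis cg : continuous g.
Hypothesis g_cvg : forall t, unitI t -> g_ j t @[j --> \oo] --> g t.
Hypothesis cK : closed K.
Hypothesis g_m : forall j, hausdorff1 ((g_ j @` unitI) `\` K) <= m%:E.

(** Each point x of s is the centre of a ball of radius r, disjoint from the
others and from K.  For large j the path [g_ j] comes within r / 2 of x.  It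
also comes near p and near q, at least one of which is at distance at least
2 r from x, so it leaves the ball. *)
Let separated_bound (p q : V) (k : nat) (r : R) (s : seq V) :
  (0 < r)%R -> (4 * r <= `|p - q|)%R -> (r < k.+1%:R^-1)%R ->
  (g @` unitI) p -> (g @` unitI) q ->
  (forall x, x \in s -> (g @` unitI `&` away K k) x) ->
  pairwise (fun x y : V => (2 * r < `|x - y|)%R) s ->
  ((size s)%:R * r <= 4 * m)%R.
Proof.
move=> r0 rpq rk [u Iu gu] [v Iv gv] sg sep.
have r20 : (0 < r / 2)%R by rewrite divr_gt0.
have close t : unitI t -> \forall j \near \oo, (`|g_ j t - g t| <= r / 2)%R.
  by move=> It; have /cvgrPdist_le/(_ _ r20) := g_cvg It;
    apply: filterS => j; rewrite distrC.
have [j [ju jv js]] : exists j, [/\ (`|g_ j u - p| <= r / 2)%R,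
    (`|g_ j v - q| <= r / 2)%R & forall x, x \in s -> exists2 t, unitI t &
      (`|g_ j t - x| <= r / 2)%R].
  have near_s : \forall j \near \oo, forall x, x \in s -> exists2 t, unitI t &
      (`|g_ j t - x| <= r / 2)%R.
    elim: s sg {sep} => [|x s IH] sg; first by apply: nearW => j x; rewrite in_nil.
    have [[t It gt] _] := sg x (mem_head _ _).
    have {}/IH IH : forall y, y \in s -> (g @` unitI `&` away K k) y.
      by move=> y ys; apply: sg; rewrite in_cons ys orbT.
    near=> j => y; rewrite in_cons => /predU1P[->|ys].
      by exists t => //; rewrite -gt; near: j; exact: close.
    by move: y ys; near: j.
  near \oo => j; exists j; split.
  - by rewrite -gu; near: j; exact: close.
  - by rewrite -gv; near: j; exact: close.
  - by near: j.
have ball_lb x : x \in s ->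
    (r / 4)%:E <= hausdorff1 (((g_ j @` unitI) `\` K) `&` cball x r).
  move=> xs; have [[t0 It0 gt0] xK] := sg x xs; have [t It gt] := js x xs.
  have [w Iw gw] : exists2 w, unitI w & (r <= `|g_ j w - x|)%R.
    have [|xp] := leP (2 * r)%R `|p - x|%R => [px|].
      exists u => //; rewrite -(lerD2r (r / 2)%R).
      apply: le_trans (le_trans px _); first lra.
      rewrite -(subrKA (g_ j u)) (le_trans (ler_normD _ _))// addrC lerD2l.
      by rewrite distrC.
    exists v => //; rewrite -(lerD2r (r / 2)%R).
    have qx : (2 * r <= `|q - x|)%R.
      rewrite -(lerD2l (2 * r)%R); apply: (@le_trans _ _ `|p - q|%R); first lra.
      by rewrite -(subrKA x) (le_trans (ler_normD _ _))// (distrC x q) lerD2r ltW.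
    apply: le_trans (le_trans qx _); first lra.
    rewrite -(subrKA (g_ j v)) (le_trans (ler_normD _ _))// addrC lerD2l.
    by rewrite distrC.
  have := hausdorff1_path_ball (@cg_ j) It Iw gt gw.
  have -> : ((g_ j @` unitI) `\` K) `&` cball x r = g_ j @` unitI `&` cball x r.
    apply/seteqP; split => [y [[]]//|y [gy yx]]; split => //; split => // Ky.
    have := xK y Ky; rewrite leNgt => /negP; apply.
    by rewrite distrC (le_lt_trans yx).
  rewrite -lee_pdivrMl// => /(le_trans _); apply.
  by rewrite -EFinM lee_fin; lra.
have := @caratheodory_sum_le R V V (@hausdorff1 R n) (fun x => cball x r) s
  ((g_ j @` unitI) `\` K) _ _.
have /[swap] /[apply] : forall x : V, (@hausdorff1 R n).-caratheodory (cball x r).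
  by move=> x; apply: closed_hausdorff1_caratheodory; exact: closed_cball.
have /[swap] /[apply] : pairwise (fun x y : V => `[< cball x r `&` cball y r = set0 >]) s.
  apply: sub_pairwise sep => x y xy; apply/asboolP/seteqP; split => // z [zx zy].
  move: xy; rewrite ltNge => /negP; apply.
  rewrite -(subrKA z) (le_trans (ler_normD _ _))// distrC mulr_natl mulr2n.
  by rewrite lerD.
move=> /le_trans /(_ (g_m j)) sum_le.
rewrite -ler_pdivrMl// mulrA -lee_fin (le_trans _ sum_le)//.
apply: (@le_trans _ _ (\sum_(x <- s) (r / 4)%:E)).
  by rewrite sumEFin big_const_seq count_predT iter_addr_0 lee_fin -mulr_natl; lra.
by rewrite big_seq [leRHS]big_seq; exact: lee_sum.
Unshelve. all: by end_near. Qed.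

(** A longest 2 r-separated sequence exists since [separated_bound] bounds the
lengths; by maximality the balls of radius 2 r around its points form a
cover.  There are at most 4 m / r of them, each of Euclidean diameter at most
4 n r, whence the constant 16 n. *)
Let cover_away (p q : V) (k : nat) (d : R) :
  (g @` unitI) p -> (g @` unitI) q -> p != q -> (0 < d)%R ->
  hausdorff1_pre d (g @` unitI `&` away K k) <= (16 * n%:R * m)%:E.
Proof.
move=> gp gq pq d0; pose X := g @` unitI `&` away K k.
have pq0 : (0 < `|p - q|)%R by rewrite normr_gt0 subr_eq0.
(* The last bound on r makes the covering sets, of diameter at most 4 n r,
   admissible at scale d; adding 1 allows for n = 0. *)
pose r := Num.min (Num.min (`|p - q| / 4) k.+2%:R^-1)%R (d / (4 * n%:R + 1))%R.
have n0 : (0 < 4 * n%:R + 1 :> R)%R by rewrite ltr_wpDl// mulr_ge0.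
have r0 : (0 < r)%R by rewrite !lt_min !divr_gt0// invr_gt0 ltr0n.
have rpq : (4 * r <= `|p - q|)%R by rewrite mulrC -ler_pdivlMr// !ge_min lexx.
have rk : (r < k.+1%:R^-1)%R.
  have rk2 : (r <= k.+2%:R^-1)%R by rewrite !ge_min lexx orbT.
  by rewrite (le_lt_trans rk2)// ltf_pV2 ?posrE ?ltr0n// ltr_nat.
have rd : (n%:R * (4 * r) <= d)%R.
  have : (r <= d / (4 * n%:R + 1))%R by rewrite !ge_min lexx orbT.
  rewrite ler_pdivlMr//; apply: le_trans; rewrite -subr_ge0.
  have -> : (r * (4 * n%:R + 1) - n%:R * (4 * r) = r)%R by ring.
  exact: ltW.
pose separated (s : seq V) := (forall x, x \in s -> X x) /\
  pairwise (fun x y : V => (2 * r < `|x - y|)%R) s.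
pose P N := `[< exists s, separated s /\ size s = N >].
have P0 : exists N, P N.
  by exists 0%N; apply/asboolP; exists [::]; split => //; split => // x; rewrite in_nil.
have Pub N : P N -> (N <= Num.truncn (4 * m / r))%N.
  move=> /asboolP[s [[sX sep] <-]].
  have sm := separated_bound r0 rpq rk gp gq sX sep.
  have mr : ((size s)%:R <= 4 * m / r)%R by rewrite ler_pdivlMr.
  by rewrite truncn_ge_nat// (le_trans _ mr).
have [N /asboolP[s [[sX sep] sN]] Nmax] := ex_maxnP P0 Pub.
pose U i := if (i < size s)%N then cball (nth 0 s i) (2 * r) else set0.
have Ud i : diameter (U i) <= (n%:R * (4 * r))%:E.
  have nr0 : (0 <= n%:R * (4 * r))%R by rewrite !mulr_ge0// ltW.
  rewrite /U; case: ifP => _; last by rewrite diameter0 lee_fin.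
  apply: diameter_le => // y z yx zx; rewrite lee_fin (le_trans (enorm_le_norm _))//.
  rewrite ler_wpM2l// -(subrKA (nth 0%R s i)) (le_trans (ler_normD _ _))//.
  by rewrite [X in (_ + X)%R]distrC (le_trans (lerD yx zx))//; lra.
have XU : X `<=` \bigcup_i U i.
  move=> x Xx; apply: contrapT => xU.
  suff /Nmax : P N.+1 by rewrite ltnn.
  apply/asboolP; exists (x :: s); split; last by rewrite /= sN.
  split=> [y|]; first by rewrite in_cons => /predU1P[->|/sX].
  rewrite pairwise_cons sep andbT; apply/allP => y ys; rewrite ltNge; apply/negP => xy.
  apply: xU; exists (index y s) => //=; rewrite /U index_mem ys /=.
  by rewrite nth_index.
apply: le_trans (hausdorff1_pre_le_diameters XU _) _.
  by move=> i; rewrite (le_trans (Ud i))// lee_fin.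
rewrite (nneseries_split _ (size s)); last by move=> *; exact: diameter_ge0.
rewrite [X in _ + X]eseries0 ?adde0; last first.
  by move=> i si _; rewrite /U ltnNge si /= diameter0.
rewrite add0n big_mkord.
apply: (@le_trans _ _ (\sum_(i < size s) (n%:R * (4 * r))%:E)).
  by apply: lee_sum => i _; exact: Ud.
rewrite sumEFin sumr_const card_ord lee_fin -[leLHS]mulr_natl.
have sm := separated_bound r0 rpq rk gp gq sX sep.
have -> : ((size s)%:R * (n%:R * (4 * r)) = 4 * n%:R * ((size s)%:R * r))%R by ring.
have -> : (16 * n%:R * m = 4 * n%:R * (4 * m))%R by ring.
by rewrite ler_wpM2l// mulr_ge0.
Qed.

(** A weak form of Golab's semicontinuity theorem, on the complement of a
closed set.  A constant limit path has a null image, and otherwise two distinct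
points of the image serve as p and q in [cover_away]. *)
Lemma hausdorff1_limit_path_le :
  hausdorff1 ((g @` unitI) `\` K) <= (16 * n%:R * m)%:E.
Proof.
have m0 : (0 <= m)%R.
  by rewrite -lee_fin (le_trans _ (g_m 0%N))// outer_measure_ge0.
have I0 : unitI (0%R : R) by rewrite /unitI /= in_itv /= lexx ler01.
have [gcst|] := pselect (g @` unitI `<=` [set g 0%R]).
  rewrite (@le_trans _ _ 0)//; last by rewrite lee_fin !mulr_ge0.
  rewrite -(hausdorff1_set1 (g 0%R)); apply: le_outer_measure.
  by move=> x [/gcst].
move=> /existsNP[q /not_implyP[gq /eqP qp]].
have gp : (g @` unitI) (g 0%R) by exists 0%R.
have bound k : hausdorff1 (g @` unitI `&` away K k) <= (16 * n%:R * m)%:E.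
  by apply: hausdorff1_le => d d0; exact: cover_away gq gp qp d0.
have cgI : closed (g @` unitI).
  apply: compact_closed; first exact: norm_hausdorff.
  apply: continuous_compact; last exact: segment_compact.
  exact: continuous_subspaceT.
pose X k := g @` unitI `&` away K k.
pose mu : {outer_measure set V -> \bar R} := @hausdorff1 R n.
have mX k : mu.-cara.-measurable (X k).
  by apply: closed_hausdorff1_caratheodory; apply: closedI => //; exact: closed_away.
have XE : (g @` unitI) `\` K = \bigcup_k X k.
  by rewrite -setI_bigcupr bigcup_away.
have := @nondecreasing_cvg_mu _ (caratheodory_type mu) R mu X mX
  (bigcupT_measurable _ mX).
have /[swap] /[apply] : nondecreasing_seq X.
  by move=> j k jk; apply/subsetPset; apply: setIS; exact: le_away.
rewrite -XE => /cvg_lim muX.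
have <- : limn (mu \o X) = hausdorff1 ((g @` unitI) `\` K) by exact: muX.
apply: lime_le; last by apply: nearW => k; exact: bound.
apply: ereal_nondecreasing_is_cvgn => j k jk; apply: le_outer_measure.
by apply: setIS; exact: le_away.
Qed.

End limit.
End golab.

(** * Derivatives of Lipschitz functions *)

Section ocitv_cover.
Context {R : realType}.
Variable nu : {measure set (measurableTypeR R) -> \bar R}.
Hypothesis nu_fin : forall a b : R, (nu `]a, b]%classic < +oo)%E.
Local Open Scope ereal_scope.

Let oc (A : set (ocitv_type R)) : \bar R := nu A.

Let oc0 : oc set0 = 0.
Proof. exact: measure0. Qed.

Let oc_ge0 A : 0 <= oc A.
Proof. exact: measure_ge0. Qed.

Let oc_sigma_additive : semi_sigma_additive oc.
Proof.
move=> F mF tF mUF; apply: (@measure_semi_sigma_additive _ _ _ nu F) => //.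
  by move=> i; apply: sub_sigma_algebra; exact: mF.
by apply: sub_sigma_algebra; exact: mUF.
Qed.

HB.instance Definition _ :=
  isMeasure.Build _ (ocitv_type R) R oc oc0 oc_ge0 oc_sigma_additive.

(** Such a measure is the extension of its own restriction to half-open
intervals, and the extension is an infimum over covers. *)
Lemma measure_ocitv_cover (A : set R) (e : R) :
  measurable A -> nu A < +oo -> (0 < e)%R ->
  exists a b : nat -> R, A `<=` \bigcup_k `]a k, b k]%classic /\
    \sum_(k <oo) nu `]a k, b k]%classic <= nu A + e%:E.
Proof.
move=> mA Aoo e0.
have sf : sigma_finite [set: ocitv_type R] oc.
  exists (fun k => `](- k%:R)%R, k%:R%R]%classic).
    exact/esym/bigcup_itvT.
  by move=> k; split; [exact: is_ocitv|exact: nu_fin].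
have ocA : mu_ext oc A = nu A.
  exact: (measure_extension_unique sf (fun X _ => erefl) mA).
have ocA_fin : mu_ext oc A \is a fin_num by rewrite ocA ge0_fin_numE.
have [_ [F [/(_ _)/cid2-/all_sig[ab /all_and2[_ Fab]] AF] <-]] :=
  lb_ereal_inf_adherent e0 ocA_fin.
rewrite -/(mu_ext oc A) ocA => Fe.
exists (fst \o ab), (snd \o ab); split.
  by under eq_bigcupr do rewrite /= Fab.
apply: ltW; apply: le_lt_trans Fe; rewrite le_eqVlt; apply/orP; left; apply/eqP.
by apply: eq_eseriesr => k _; rewrite /= Fab.
Qed.

End ocitv_cover.

Section lipschitz_density.
Context {R : realType}.
Variables (f : R -> R) (C : R).
Hypothesis C0 : 0 < C.
Hypothesis f_lip : forall s t, `|f s - f t| <= C * `|s - t|.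

Let F t := f t + C * t.

Let F_nd : {homo F : s t / s <= t}.
Proof.
move=> s t st; have := f_lip s t.
rewrite ler_norml distrC (ger0_norm (_ : 0 <= t - s)) ?subr_ge0// => /andP[_].
by rewrite /F; lra.
Qed.

Let F_incr s t : s <= t -> F t - F s <= 2 * C * (t - s).
Proof.
move=> st; have := f_lip s t.
rewrite ler_norml distrC (ger0_norm (_ : 0 <= t - s)) ?subr_ge0// => /andP[+ _].
by rewrite /F; lra.
Qed.

Let f_continuous : continuous f.
Proof.
move=> t; apply/cvgrPdist_lt => e e0; near=> s.
rewrite (le_lt_trans (f_lip t s))// mulrC -ltr_pdivlMr//.
by near: s; apply: cvgr_dist_lt; [exact: cvg_id|exact: divr_gt0].
Unshelve. all: by end_near. Qed.

Let F_rc : right_continuous F.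
Proof.
apply: right_continuousW => t; apply: cvgD; first exact: f_continuous.
by apply: cvgMr; exact: cvg_id.
Qed.

HB.instance Definition _ := isCumulative.Build R _ R F F_nd F_rc.

Local Notation muF := (lebesgue_stieltjes_measure F).
Local Notation leb := (@lebesgue_measure R).
Local Open Scope ereal_scope.

Let muF_itv a b : (a <= b)%R -> muF `]a, b]%classic = (F b - F a)%:E.
Proof.
move=> ab; rewrite /lebesgue_stieltjes_measure /measure_extension.
by rewrite measurable_mu_extE/= ?wlength_itv_bnd//; exact: is_ocitv.
Qed.

Let leb_itv (a b : R) : leb `]a, b]%classic = (if (a < b)%R then b - a else 0)%:E.
Proof. by rewrite lebesgue_measure_itv /= lte_fin; case: ifP. Qed.

Let leb_fin (a b : R) : leb `]a, b]%classic < +oo.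
Proof. by rewrite leb_itv ltry. Qed.

Let muF_itv_le a b : muF `]a, b]%classic <= (2 * C)%:E * leb `]a, b]%classic.
Proof.
rewrite leb_itv; case: ltP => ab; last first.
  have E : `]a, b]%classic = set0 :> set (measurableTypeR R).
    by rewrite set_itv_ge// bnd_simp -leNgt.
  by rewrite mule0 E measure0.
by rewrite (muF_itv (ltW ab)) -EFinM lee_fin F_incr// ltW.
Qed.

Let muF_dominated : muF `<< leb.
Proof.
apply/null_content_dominatesP => A mA leb0.
apply/eqP; rewrite eq_le measure_ge0 andbT; apply/lee_addgt0Pr => e e0; rewrite add0e.
have C20 : (0 < 2 * C)%R by rewrite mulr_gt0.
have [||||a [b [Aab abe]]] := @measure_ocitv_cover R leb _ A (e / (2 * C))%R.
- exact: leb_fin.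
- exact: mA.
- by rewrite leb0 ltry.
- exact: divr_gt0.
have muA : muF A <= \sum_(k <oo) muF `]a k, b k]%classic.
  apply: (measure_sigma_subadditive muF (fun k => measurable_itv `]a k, b k]) mA Aab).
apply: (le_trans muA).
apply: (@le_trans _ _ (\sum_(k <oo) (2 * C)%:E * leb `]a k, b k]%classic)).
  by apply: lee_nneseries => [k _ _|k _]; [exact: measure_ge0|exact: muF_itv_le].
rewrite nneseriesZl; last by move=> k _; exact: measure_ge0.
by rewrite -lee_pdivlMl// (le_trans abe)// leb0 add0e -EFinM lee_fin mulrC.
Qed.

Let D : set (measurableTypeR R) := `](-1)%R, 2%R]%classic.

Let mD : measurable D. Proof. exact: measurable_itv. Qed.

Let muF_D : muF D < +oo.
Proof. by rewrite muF_itv ?ltry//; lra. Qed.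

Let nu : {finite_measure set (measurableTypeR R) -> \bar R} := mfrestr mD muF_D.

Let nu_dominated : nu `<< leb.
Proof.
apply/null_content_dominatesP => A mA leb0.
have /null_content_dominatesP/(_ A mA leb0) muA := muF_dominated.
apply/eqP; rewrite eq_le measure_ge0 andbT -muA.
by apply: le_measure; rewrite ?inE//; exact: measurableI.
Qed.

(** The function F t = f t + C t is nondecreasing with slopes at most 2 C.  Its
Stieltjes measure is therefore absolutely continuous, and F is the integral of
the Radon-Nikodym density, which is the derivative of F at every Lebesgue
point.  Subtracting C gives h.  The window ]-1, 2] makes the measure finite
and has the unit interval in its interior. *)
Let lipschitz_density_itv : exists h : R -> R,
  [/\ leb.-integrable `](-1)%R, 2%R]%classic (EFin \o h),
      forall a b : R, (-1 <= a)%R -> (a <= b)%R -> (b <= 2)%R ->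
        (f b - f a)%:E = \int[leb]_(t in `]a, b]%classic) (h t)%:E &
      {ae leb, forall t, (-1 < t < 2)%R -> derivable f t 1%R /\ derive1 f t = h t}].
Proof.
have [q [q0 qfin qint nuq]] := radon_nikodym_sigma_finite nu_dominated.
pose p := fine \o q.
have pq : EFin \o p = q by apply/funext => t; rewrite /p /= fineK.
have intp : leb.-integrable setT (EFin \o p) by rewrite pq.
have intC (a b : R) : leb.-integrable `]a, b]%classic (EFin \o cst C).
  apply/integrableP; split; first exact/measurable_EFinP/measurable_cst.
  rewrite (eq_integral (cst `|C%:E|))// integral_cst; last exact: measurable_itv.
  by apply: lte_mul_pinfty => //; exact: leb_fin.
have Fp (a b : R) : (-1 <= a)%R -> (a <= b)%R -> (b <= 2)%R ->
    (F b - F a)%:E = \int[leb]_(t in `]a, b]%classic) (p t)%:E.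
  move=> a1 ab b2; rewrite -muF_itv//.
  have <- : nu `]a, b]%classic = muF `]a, b]%classic.
    change (muF (`]a, b]%classic `&` D) = muF `]a, b]%classic); congr (muF _).
    apply/setIidPl => t; rewrite /D /= !in_itv /= => /andP[at_ tb].
    by rewrite (le_lt_trans a1) ?(le_trans tb).
  by rewrite (nuq _ (measurable_itv `]a, b])); apply: eq_integral => t _; rewrite -pq.
have intpS (a b : R) : leb.-integrable `]a, b]%classic (EFin \o p).
  by apply: integrableS intp => //; exact: measurable_itv.
exists (fun t => p t - C)%R; split.
- rewrite (_ : EFin \o _ = (EFin \o p) \- (EFin \o cst C)); last exact/funext.
  apply: integrableB; [exact: measurable_itv|exact: intpS|exact: intC].
- move=> a b a1 ab b2; under eq_integral do rewrite EFinB.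
  rewrite (@integralB_EFin _ _ _ leb _ _ _ (measurable_itv `]a, b])
    (intpS a b) (intC a b)).
  have lebE : leb `]a, b]%classic = (b - a)%:E.
    by rewrite leb_itv; case: ltgtP ab => // -> _; rewrite subrr.
  have -> : \int[leb]_(x in `]a, b]%classic) (cst C x)%:E = C%:E * (b - a)%:E.
    by rewrite -lebE; exact: (@integral_cst _ _ _ leb _ (measurable_itv `]a, b]) C%:E).
  rewrite -Fp//.
  by rewrite -EFinM -EFinB; congr EFin; rewrite /F; ring.
have := @FTC1 R p (BRight (-1)%R) _ (open_integrable_locally openT intp).
move=> /(_ (intpS _)) /=; apply: (@filterS _ _ (ae_filter_ringOfSetsType leb)).
move=> t tP /andP[t1 t2].
pose g y := (\int[leb]_(u in `](-1)%R, y]%classic) p u)%R.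
have [dg g't] : derivable g t 1%R /\ derive1 g t = p t by apply: tP; rewrite lte_fin.
have ig : is_derive t 1%R g (p t) by apply: DeriveDef => //; rewrite -derive1E.
have gE : \forall y \near t, (g y - C * y + F (-1) = f y)%R.
  have : t \in `](-1)%R, 2%R[ by rewrite in_itv /= t1 t2.
  move=> /near_in_itvoo; apply: filterS => y; rewrite in_itv /= => /andP[/ltW y1 /ltW y2].
  have -> : (g y = F y - F (-1))%R by rewrite /g /Rintegral -Fp.
  by rewrite /F; ring.
have if_ : is_derive t 1%R f (p t - C)%R.
  apply: (near_eq_is_derive gE).
  rewrite -[X in is_derive _ _ _ X]addr0; apply: is_deriveD; apply: is_deriveB.
  rewrite -[X in is_derive _ _ _ X]mulr1; exact: (is_deriveZ C (is_derive_id t 1%R)).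
by split; [exact: ex_derive|rewrite derive1E; exact: derive_val].
Qed.

(** Extending the density by 0 outside the window makes it integrable on the
whole line. *)
Lemma lipschitz_density : exists h : R -> R,
  [/\ leb.-integrable setT (EFin \o h),
      forall a b : R, (-1 <= a)%R -> (a <= b)%R -> (b <= 2)%R ->
        (f b - f a)%:E = \int[leb]_(t in `]a, b]%classic) (h t)%:E &
      {ae leb, forall t, (-1 < t < 2)%R -> derivable f t 1%R /\ derive1 f t = h t}].
Proof.
have [h [inth fh aeh]] := lipschitz_density_itv.
have hD t : D t -> (h \_ D) t = h t by move=> Dt; rewrite patchE mem_set.
exists (h \_ D); split.
- by rewrite -restrict_EFin -(integrable_mkcond _ mD).
- move=> a b a1 ab b2; rewrite fh//; apply: eq_integral => t.
  rewrite inE /= in_itv /= => /andP[at_ tb]; rewrite hD// /D /= in_itv /=.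
  by rewrite (le_lt_trans a1)// (le_trans tb).
- apply: (@filterS _ _ (ae_filter_ringOfSetsType leb)) aeh => t + t12.
  move=> /(_ t12)[dft ->]; split => //; rewrite hD// /D /= in_itv /=.
  by case/andP: t12 => -> /ltW ->.
Qed.

End lipschitz_density.

(** * Length of the image of a path *)

Section image_le_measure.
Context {R : realType} {n : nat}.
Local Notation V := 'rV[R]_n.
Local Open Scope ereal_scope.
Variables (m : {measure set (measurableTypeR R) -> \bar R}) (g : R -> V) (C u v : R).
Hypothesis C0 : (0 < C)%R.
Hypothesis m_fin : forall a b : R, m `]a, b]%classic < +oo.
Hypothesis g_lip : forall s t, (enorm (g s - g t) <= C * `|s - t|)%R.
Hypothesis g_m : forall s t, (u <= s)%R -> (s <= t)%R -> (t <= v)%R ->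
  (enorm (g t - g s))%:E <= m `]s, t]%classic.

Let enorm_le_m (a b c c' s t : R) : (u <= c)%R -> (c' <= v)%R ->
  (a < s <= b)%R -> (c < s <= c')%R -> (a < t <= b)%R -> (c < t <= c')%R ->
  (enorm (g s - g t))%:E <= m `]a, b]%classic.
Proof.
move=> uc c'v; wlog st : s t / (t <= s)%R.
  move=> wl; have [|/ltW] := leP t s; first exact: wl.
  rewrite -(opprB (g t)) /enorm => ts ? ? ? ?.
  under eq_bigr do rewrite mxE sqrrN.
  exact: wl.
move=> /andP[as_ sb] /andP[cs sc'] /andP[at_ tb] /andP[ct tc'].
apply: le_trans (g_m _ _ _) _ => //.
- exact: le_trans uc (ltW ct).
- exact: le_trans sc' c'v.
- apply: le_measure; rewrite ?inE; [exact: measurable_itv..|].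
  by apply: subset_itv; rewrite bnd_simp// ltW.
Qed.

(** The interval ]c, c'] is so short that its image has diameter at most d.
Intervals that cover A at almost no loss of measure are cut down to it, and
their images then form an admissible cover at scale d. *)
Let local_le (d c c' : R) (A : set (measurableTypeR R)) :
  (0 <= d)%R -> (u <= c)%R -> (c' <= v)%R -> (C * (c' - c) <= d)%R ->
  measurable A -> A `<=` `]c, c']%classic ->
  hausdorff1_pre d (g @` A) <= m A.
Proof.
move=> d0 uc c'v cd mA Acc'.
have mA_fin : m A < +oo.
  apply: le_lt_trans (m_fin c c').
  by apply: le_measure; rewrite ?inE//; exact: measurable_itv.
apply/lee_addgt0Pr => e e0.
have [a [b [Aab abe]]] := measure_ocitv_cover m_fin mA mA_fin e0.
pose U k := g @` (`]a k, b k]%classic `&` `]c, c']%classic).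
apply: le_trans (le_trans _ abe).
  apply: (@hausdorff1_pre_le_diameters _ _ d _ U).
    move=> _ [t At <-]; have [k _ abt] := Aab t At.
    by exists k => //; exists t => //; split => //; exact: Acc'.
  move=> k; apply: diameter_le; first by rewrite lee_fin.
  move=> _ _ [s [_ /= +] <-] [t [_ /= +] <-]; rewrite !in_itv /=.
  move=> /andP[cs sc'] /andP[ct tc']; rewrite lee_fin.
  rewrite (le_trans (g_lip _ _))// (le_trans _ cd)// ler_pM2l// ler_distl.
  by apply/andP; split; lra.
apply: lee_nneseries => [k _ _|k _]; first exact: diameter_ge0.
apply: diameter_le; first exact: measure_ge0.
move=> _ _ [s [/= + +] <-] [t [/= + +] <-]; rewrite !in_itv /=.
by move=> ? ? ? ?; exact: (@enorm_le_m _ _ c c').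
Qed.

Let bisect_le (N : nat) (d c c' : R) (A : set (measurableTypeR R)) :
  (0 <= d)%R -> (u <= c)%R -> (c <= c')%R -> (c' <= v)%R ->
  (C * (c' - c) <= 2 ^+ N * d)%R -> measurable A -> A `<=` `]c, c']%classic ->
  hausdorff1_pre d (g @` A) <= m A.
Proof.
move=> d0; elim: N c c' A => [|N IH] c c' A uc cc' c'v cd mA Acc'.
  by apply: (@local_le d c c') => //; rewrite expr0 mul1r in cd.
pose w := ((c + c') / 2)%R.
have cw : (c <= w)%R by rewrite /w; lra.
have wc' : (w <= c')%R by rewrite /w; lra.
pose Al := A `&` `]-oo, w]%classic; pose Ar := A `\` `]-oo, w]%classic.
have mAl : measurable Al by apply: measurableI => //; exact: measurable_itv.
have mAr : measurable Ar by apply: measurableD => //; exact: measurable_itv.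
have AE : A = Al `|` Ar.
  by rewrite setUIDK.
have -> : m A = m Al + m Ar.
  by rewrite addeC; apply: measureDI => //; exact: measurable_itv.
rewrite AE image_setU (le_trans (hausdorff1_pre_setU _ _ d0))//.
rewrite exprS in cd.
apply: leeD.
- apply: (IH c w) => //; first exact: le_trans c'v.
    by rewrite /w; lra.
  move=> t [At]; rewrite /= !in_itv /= => ->; rewrite andbT.
  by have := Acc' t At; rewrite /= in_itv /= => /andP[].
- apply: (IH w c') => //; first exact: le_trans cw.
    by rewrite /w; lra.
  move=> t [At]; rewrite /= !in_itv /= => /negP; rewrite -ltNge => -> /=.
  by have := Acc' t At; rewrite /= in_itv /= => /andP[].
Qed.

(** Bisection reduces the claim to intervals short enough for the scale d,
where [local_le] applies; both sides are additive enough for the pieces to be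
put together. *)
Lemma hausdorff1_image_le_measure (A : set (measurableTypeR R)) :
  (u <= v)%R -> measurable A -> A `<=` `]u, v]%classic ->
  hausdorff1 (g @` A) <= m A.
Proof.
move=> uv mA Auv; apply: hausdorff1_le => d d0.
pose N := Num.truncn (C * (v - u) / d).
apply: (@bisect_le N.+1 d u v) => //; first exact: ltW.
rewrite -ler_pdivrMr// ltW// (lt_le_trans (truncnS_gt _))//.
by rewrite -natrX ler_nat ltnW// ltn_expl.
Qed.

End image_le_measure.

Section lipschitz_path.
Context {R : realType} {n : nat}.
Local Notation V := 'rV[R]_n.
Local Notation leb := (@lebesgue_measure R).
Local Open Scope ereal_scope.

Section density_measure.
Variable k : R -> R.
Hypothesis k_ge0 : forall t, (0 <= k t)%R.
Hypothesis k_int : leb.-integrable setT (EFin \o k).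

Let m (A : set (measurableTypeR R)) := \int[leb]_(t in A) (k t)%:E.

Let m0 : m set0 = 0.
Proof. exact: integral_set0. Qed.

Let m_ge0 A : 0 <= m A.
Proof. by apply: integral_ge0 => t _; rewrite lee_fin. Qed.

Let m_sigma_additive : semi_sigma_additive m.
Proof.
apply: semi_sigma_additive_nng_induced; first exact: measurable_int k_int.
by move=> t; rewrite lee_fin.
Qed.

HB.instance Definition _ := isMeasure.Build _ _ R m m0 m_ge0 m_sigma_additive.

Lemma hausdorff1_image_le_integral (g : R -> V) (C u v : R)
    (A : set (measurableTypeR R)) : (0 < C)%R ->
  (forall s t, (enorm (g s - g t) <= C * `|s - t|)%R) ->
  (forall s t, (u <= s)%R -> (s <= t)%R -> (t <= v)%R ->
    (enorm (g t - g s))%:E <= \int[leb]_(x in `]s, t]%classic) (k x)%:E) ->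
  (u <= v)%R -> measurable A -> A `<=` `]u, v]%classic ->
  hausdorff1 (g @` A) <= \int[leb]_(x in A) (k x)%:E.
Proof.
move=> C0 g_lip g_k uv mA Auv.
apply: (@hausdorff1_image_le_measure _ _ m g C u v) => //.
move=> a b; rewrite -ge0_fin_numE; last exact: m_ge0.
apply: integrable_fin_num; first exact: measurable_itv.
by apply: integrableS k_int => //; exact: measurable_itv.
Qed.

End density_measure.

(** The density k is the sum of the moduli of the derivatives of the
coordinates, each of which is at most the norm of the derivative of g. *)
Lemma lipschitz_path_density (g : R -> V) (C : R) : (0 < C)%R ->
  (forall s t, (enorm (g s - g t) <= C * `|s - t|)%R) ->
  exists k : R -> R,
  [/\ leb.-integrable setT (EFin \o k), forall t, (0 <= k t)%R,
      forall A : set (measurableTypeR R), measurable A -> A `<=` unitI ->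
        hausdorff1 (g @` A) <= \int[leb]_(x in A) (k x)%:E &
      {ae leb, forall t, (0 < t < 1)%R -> (k t <= n%:R * enorm (derive1 g t))%R}].
Proof.
move=> C0 g_lip.
have /choice[h hP] : forall i : 'I_n, exists h : R -> R,
    [/\ leb.-integrable setT (EFin \o h),
    forall a b : R, (-1 <= a)%R -> (a <= b)%R -> (b <= 2)%R ->
      (g b ord0 i - g a ord0 i)%:E = \int[leb]_(t in `]a, b]%classic) (h t)%:E &
    {ae leb, forall t, (-1 < t < 2)%R -> derivable (fun t => g t ord0 i) t 1%R /\
      derive1 (fun t => g t ord0 i) t = h t}].
  move=> i; apply: lipschitz_density C0 _ => s t; apply: le_trans (g_lip s t).
  by have := coord_le_enorm (g s - g t) i; rewrite !mxE.
pose k t := (\sum_(i < n) `|h i t|)%R.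
have int_h i : leb.-integrable setT (EFin \o h i) by have [] := hP i.
have k_int : leb.-integrable setT (EFin \o k).
  rewrite (_ : EFin \o k = fun t => \sum_(i < n) (abse \o (EFin \o h i)) t); last first.
    by apply/funext => t; rewrite /k /= -sumEFin.
  apply: integrable_sum => // i _; exact: integrable_abse.
have k_ge0 t : (0 <= k t)%R by rewrite /k sumr_ge0.
have g_k (s t : R) : (-1 <= s)%R -> (s <= t)%R -> (t <= 2)%R ->
    (enorm (g t - g s))%:E <= \int[leb]_(x in `]s, t]%classic) (k x)%:E.
  move=> s1 st t2.
  have mst : (measurable : set (set (measurableTypeR R))) `]s, t]%classic.
    exact: measurable_itv.
  have -> : \int[leb]_(x in `]s, t]%classic) (k x)%:E =
      \sum_(i < n) \int[leb]_(x in `]s, t]%classic) `|(h i x)%:E|.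
    rewrite -ge0_integral_sum//.
      by apply: eq_integral => x _; rewrite /k -sumEFin.
    move=> i; apply: measurableT_comp => //.
    by apply: measurable_funTS; exact: measurable_int (int_h i).
  rewrite (@le_trans _ _ (\sum_(i < n) `|(g t - g s) ord0 i|)%:E)//.
    by rewrite lee_fin enorm_le_sum.
  rewrite -sumEFin; apply: lee_sum => i _.
  have [_ hi _] := hP i; rewrite !mxE -abse_EFin hi//.
  apply: le_abse_integral => //; apply: measurable_funTS.
  exact: measurable_int (int_h i).
exists k; split => //.
- move=> A mA AI; apply: (hausdorff1_image_le_integral k_ge0 k_int C0 g_lip g_k) => //.
    by rewrite (@le_trans _ _ 0%R)// lerN10.
  move=> t /AI; rewrite /unitI /= !in_itv /= => /andP[t0 t1].
  by rewrite (lt_le_trans _ t0) ?ltrN10//= (le_trans t1)// ler1n.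
- have : {ae leb, forall t, forall i, (-1 < t < 2)%R ->
      derivable (fun t => g t ord0 i) t 1%R /\ derive1 (fun t => g t ord0 i) t = h i t}.
    have := @filter_forall _ _ (fun i t => (-1 < t < 2)%R ->
      derivable (fun t => g t ord0 i) t 1%R /\ derive1 (fun t => g t ord0 i) t = h i t)
      _ (ae_filter_ringOfSetsType leb).
    by apply => i; have [] := hP i.
  apply: (@filterS _ _ (ae_filter_ringOfSetsType leb)) => t ht /andP[t0 t1].
  have t12 : (-1 < t < 2)%R by rewrite (lt_trans _ t0) ?ltrN10//= (lt_trans t1)// ltr1n.
  have dg : derivable g t 1%R.
    by apply/derivable_mxP => i j; rewrite (ord1 i); exact: (ht j t12).1.
  rewrite mulr_natl -[X in (_ *+ X)%R]card_ord -sumr_const; apply: ler_sum => i _.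
  rewrite -(ht i t12).2 derive1E (_ : 'D_1 _ t = derive1 g t ord0 i); last first.
    by rewrite derive1E derive_mx// mxE.
  exact: coord_le_enorm.
Qed.

End lipschitz_path.

Section lower_integral.
Context {d} {T : measurableType d} {R : realType}.
Variable mu : {measure set T -> \bar R}.
Local Open Scope ereal_scope.

(** The integral of a nonnegative function is a supremum over the simple
functions below it, hence monotone for arbitrary functions.  This matters for
the derivative of a path: it is only almost everywhere equal to a Borel
function. *)
Lemma ge0_le_integral_nonmeasurable (D : set T) (f1 f2 : T -> \bar R) :
  (forall x, D x -> 0 <= f1 x) -> (forall x, D x -> f1 x <= f2 x) ->
  \int[mu]_(x in D) f1 x <= \int[mu]_(x in D) f2 x.
Proof.
move=> f10 f12; have f20 x : D x -> 0 <= f2 x.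
  by move=> Dx; exact: le_trans (f10 x Dx) (f12 x Dx).
rewrite !ge0_integralE//; apply: le_ereal_sup => _ [h hf1 <-].
exists h => // x; apply: le_trans (hf1 x) _.
by rewrite !patchE; case: ifPn => // /[!inE] Dx; exact: f12.
Qed.

End lower_integral.

Section clamp.
Context {R : realType}.

(** Precomposing with the projection onto the unit interval extends a Lipschitz
path to the whole line with the same constant and the same image. *)
Definition clamp (t : R) : R := if t < 0 then 0 else if 1 < t then 1 else t.

Lemma clamp_unitI t : unitI (clamp t).
Proof.
rewrite /unitI /= in_itv /= /clamp.
by case: (ltP t 0) => ?; case: (ltP 1 t) => ?; apply/andP; split; lra.
Qed.

Lemma clamp_id t : unitI t -> clamp t = t.
Proof. by rewrite /unitI /= in_itv /= /clamp => /andP[t0 t1]; rewrite !ltNge t0 t1. Qed.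

Lemma clamp_dist s t : `|clamp s - clamp t| <= `|s - t|.
Proof.
wlog st : s t / s <= t.
  move=> wl; have [|/ltW] := leP s t; first exact: wl.
  by rewrite (distrC (clamp s)) (distrC s); exact: wl.
rewrite (distrC (clamp s)) (distrC s) [leRHS]ger0_norm ?subr_ge0// ger0_norm /clamp;
  by case: (ltP s 0) => ?; case: (ltP 1 s) => ?; case: (ltP t 0) => ?;
    case: (ltP 1 t) => ?; lra.
Qed.

Lemma image_clamp {T : Type} (g : R -> T) (A : set R) :
  A `<=` unitI -> (g \o clamp) @` A = g @` A.
Proof.
move=> AI; apply/seteqP; split => _ [t At <-]; exists t => //=;
  by rewrite clamp_id//; exact: AI.
Qed.

End clamp.

Section path_cost.
Context {R : realType} {n : nat}.
Local Notation V := 'rV[R]_n.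
Local Notation leb := (@lebesgue_measure R).
Variables (g : R -> V) (C : R).
Hypothesis C0 : 0 < C.
Hypothesis g_lip : elipschitz C unitI g.

Lemma elipschitz_clamp s t : enorm ((g \o clamp) s - (g \o clamp) t) <= C * `|s - t|.
Proof.
apply: le_trans (g_lip (clamp_unitI s) (clamp_unitI t)) _.
by rewrite ler_pM2l// clamp_dist.
Qed.

Lemma continuous_clamp : continuous (g \o clamp).
Proof.
move=> t; apply/cvgrPdist_lt => e e0; near=> s.
rewrite (le_lt_trans (norm_le_enorm _))// (le_lt_trans (elipschitz_clamp _ _))//.
rewrite mulrC -ltr_pdivlMr//.
by near: s; apply: cvgr_dist_lt; [exact: cvg_id|exact: divr_gt0].
Unshelve. all: by end_near. Qed.

Lemma measurable_preimage_path (B : set V) :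
  borel_set B -> measurable (unitI `&` g @^-1` B : set R).
Proof.
move=> bB; have -> : unitI `&` g @^-1` B = unitI `&` (g \o clamp) @^-1` B.
  by apply/seteqP; split => t [It]; rewrite /preimage /= clamp_id.
apply: measurableI; first exact: measurable_itv.
move: B bB; apply: smallest_sub => [|U oU /=].
  split => [|B mB|B mB] /=; first by rewrite preimage_set0.
    by rewrite setTD preimage_setC; exact: measurableC.
  by rewrite preimage_bigcup; exact: bigcupT_measurable.
apply: open_measurable; move/continuousP : continuous_clamp; exact.
Qed.

Lemma derive1_clamp t : 0 < t < 1 -> derive1 (g \o clamp) t = derive1 g t.
Proof.
move=> t01; rewrite !derive1E; apply: near_eq_derive.
have : t \in `]0, 1[ by rewrite in_itv.
move/near_in_itvoo; apply: filterS => s; rewrite in_itv /= => /andP[/ltW s0 /ltW s1].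
by rewrite /= clamp_id// /unitI /= in_itv /= s0.
Qed.

Local Open Scope ereal_scope.

(** Off a null set, the density k of [lipschitz_path_density] is at most n
times the norm of the derivative, and the weight is at least l on A.  The
factor n + 1 in place of n allows a division when n = 0. *)
Lemma hausdorff1_image_le_path_cost (beta : V -> \bar R) (A : set R) (l M : R) :
  (forall t, unitI t -> 0 <= beta (g t)) -> (0 < l)%R ->
  measurable A -> A `<=` unitI -> (forall t, A t -> l%:E <= beta (g t)) ->
  path_cost beta g <= M%:E ->
  hausdorff1 (g @` A) <= (n.+1%:R * M / l)%:E.
Proof.
move=> beta0 l0 mA AI lbeta costM.
have [k [k_int k0 kA [N [mN N0 kN]]]] := lipschitz_path_density C0 elipschitz_clamp.
have mk : measurable_fun setT (EFin \o k) by exact: measurable_int k_int.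
(* The end points join the null set because clamping alters the derivative there. *)
pose N' : set (measurableTypeR R) := N `|` [set 0%R] `|` [set 1%R].
have mN' : measurable N'.
  by apply: measurableU; [apply: measurableU => //|]; exact: measurable_set1.
have N'0 : leb N' = 0.
  have m1 (a : R) : (measurable : set (set (measurableTypeR R))) [set a].
    exact: measurable_set1.
  by apply: null_set_setU; [exact: measurableU|exact: m1| |exact: lebesgue_measure_set1];
    apply: null_set_setU => //; exact: lebesgue_measure_set1.
have c0 : (0 <= l / n.+1%:R)%R by rewrite divr_ge0// ltW.
have mAN : (measurable : set (set (measurableTypeR R))) (A `\` N') by exact: measurableD.
have main : (l / n.+1%:R)%:E * \int[leb]_(t in A) (k t)%:E <= M%:E.
  rewrite (@ge0_negligible_integral _ _ _ leb A N')//; first last.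
  - by move=> t _; rewrite lee_fin.
  - exact: measurable_funTS.
  rewrite -ge0_integralZl//; first last.
  - by move=> t _; rewrite lee_fin.
  - exact: measurable_funTS.
  apply: le_trans costM.
  have IA : unitI `&` (A `\` N') = A `\` N' by apply/setIidPr => t [/AI].
  rewrite /path_cost -[X in integral _ X _]IA.
  rewrite integral_mkcondr; apply: ge0_le_integral_nonmeasurable => t It; rewrite patchE.
    by case: ifP => // _; rewrite mule_ge0 ?lee_fin.
  case: ifPn => [|_]; last by rewrite mule_ge0 ?beta0// lee_fin enorm_ge0.
  rewrite inE => -[At N't]; have t01 : (0 < t < 1)%R.
    have := AI t At; rewrite /unitI /= in_itv /= => /andP[t0 t1].
    rewrite !lt_neqAle t0 t1 !andbT; apply/andP; split; apply/eqP => t01; apply: N't.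
      by left; right.
    by right.
  have kt : (k t <= n%:R * enorm (derive1 g t))%R.
    rewrite -derive1_clamp//; apply: contrapT => kt; apply: N't; left; left.
    by apply: kN => /(_ t01).
  apply: (@le_trans _ _ (l%:E * (enorm (derive1 g t))%:E)).
    rewrite -!EFinM lee_fin -mulrA ler_pM2l// ler_pdivrMl//.
    by rewrite (le_trans kt)// ler_wpM2r ?enorm_ge0// ler_nat.
  by rewrite lee_wpmul2r ?lee_fin ?enorm_ge0// lbeta.
rewrite -(image_clamp g AI) (le_trans (kA A mA AI))//.
have c1 : 0 <= (n.+1%:R / l)%:E by rewrite lee_fin divr_ge0// ltW.
have := lee_wpmul2l c1 main.
rewrite muleA -!EFinM.
have -> : (n.+1%:R / l * (l / n.+1%:R) = 1)%R.
  by rewrite mulrA divfK ?gt_eqF// divff.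
by rewrite mul1e mulrAC.
Qed.

End path_cost.

(** * The limit path and the sublevel sets *)

Section sublevel.
Context {R : realType} {n : nat}.

(** Lower semicontinuity on S makes the set closed relative to S: it is S minus
the interior U of the points that are outside S or have b > l. *)
Lemma sublevel_borel (S : set 'rV[R]_n) (b : 'rV[R]_n -> R) (l : R) :
  borel_set S -> lsc_on S b -> borel_set (sublevel S b l).
Proof.
move=> bS lscb; pose U := interior [set y | S y -> l < b y].
have -> : sublevel S b l = S `&` ~` U.
  apply/seteqP; split => z [Sz bz]; split => //.
    by move=> /interior_subset/(_ Sz); rewrite ltNge bz.
  rewrite leNgt; apply/negP => lb; apply: bz.
  have [|W SW lW] := lscb z l; first by rewrite lte_fin.
  have {}SW : within S (nbhs z) W by rewrite nbhs_subspace_in.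
  move: SW; rewrite /within /= => SW.
  rewrite /U /interior; apply: filterS SW => y Wy Sy.
  by have := lW y (Wy Sy); rewrite lte_fin.
have -> : S `&` ~` U = ~` (~` S `|` U) by rewrite setCU setCK.
apply: sigma_algebraC; rewrite -bigcup2E; apply: sigma_algebra_bigcup => -[|[|i]] /=.
- exact: sigma_algebraC.
- by apply: sub_sigma_algebra; exact: open_interior.
- exact: sigma_algebra0.
Qed.

End sublevel.

Theorem proposition2p1p8 (R : realType) (n : nat)
    (S : set 'rV[R]_n) (b : 'rV[R]_n -> R) (a : \bar R)
    (S_cube : S `<=` cube)
    (S_rect : countably_1_rectifiable S)
    (S_borel : borel_set S)
    (b_ge0 : forall z, S z -> 0 <= b z)
    (b_lsc : lsc_on S b)
    (a_infty : a = +oo%E)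
    (S_fin : forall l : R, 0 <= l -> (hausdorff1 (sublevel S b l) < +oo)%E)
    (C : R) (C_gt0 : 0 < C)
    (gamma_ : nat -> R -> 'rV[R]_n) (gamma : R -> 'rV[R]_n)
    (gamma_C : forall j, lipschitz_paths C (gamma_ j))
    (L_bounded : exists M : R, forall j,
       (path_cost (extend_weight a S b) (gamma_ j) <= M%:E)%E)
    (gammaC : lipschitz_paths C gamma)
    (gamma_cvg : {uniform unitI, gamma_ @ \oo --> gamma}) :
  (forall delta : R, 0 < delta ->
     exists l : R, 0 <= l /\
       (hausdorff1 ((gamma @` unitI) `\` sublevel S b l) <= delta%:E)%E) /\
  hausdorff1 ((gamma @` unitI) `\` S) = 0%E.
Proof.
suff main : forall delta : R, 0 < delta -> exists l : R, 0 <= l /\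
    (hausdorff1 ((gamma @` unitI) `\` sublevel S b l) <= delta%:E)%E.
  split => //; apply/eqP; rewrite eq_le outer_measure_ge0 andbT.
  apply/lee_addgt0Pr => e /main[l [_ le_e]]; rewrite add0e; apply: le_trans le_e.
  by apply: le_outer_measure; apply: setDS => z [].
move=> delta delta0; have [M costM] := L_bounded.
(* Chosen so that 16 n ((n + 1) |M| + 1) / l <= delta and l > 0. *)
pose l : R := 16 * n%:R * (n.+1%:R * `|M| + 1) / delta + 1.
have l0 : 0 < l.
  have m0 : 0 <= 16 * n%:R * (n.+1%:R * `|M| + 1) :> R.
    by rewrite mulr_ge0 ?mulr_ge0// addr_ge0// mulr_ge0.
  by rewrite /l ltr_wpDl// divr_ge0//; exact: ltW.
exists l; split; first exact: ltW.
have bSl := sublevel_borel l S_borel b_lsc.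
have linv0 : 0 < l^-1 by rewrite invr_gt0.
have [K [cK KS SK]] := hausdorff1_inner_regular bSl (S_fin l (ltW l0)) linv0.
have beta0 z : (0 <= extend_weight a S b z)%E.
  by rewrite /extend_weight a_infty; case: ifPn => [/set_mem/b_ge0|].
(* The part outside S_l is controlled by the cost, the part in S_l by K. *)
have image_j j :
    (hausdorff1 ((gamma_ j @` unitI) `\` K) <= ((n.+1%:R * `|M| + 1) / l)%:E)%E.
  have [_ lip_j] := gamma_C j.
  pose A := unitI `&` gamma_ j @^-1` (~` sublevel S b l).
  have mA : measurable A.
    apply: measurable_preimage_path C_gt0 lip_j _ _; exact: sigma_algebraC.
  have gA : (hausdorff1 (gamma_ j @` A) <= (n.+1%:R * M / l)%:E)%E.
    apply: (hausdorff1_image_le_path_cost C_gt0 lip_j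
      (beta := extend_weight a S b)) => //.
    - by move=> t [].
    - move=> t [_ /= gt]; rewrite /extend_weight a_infty.
      case: ifPn => [/set_mem Sgt|_]; last by rewrite leey.
      by rewrite lee_fin leNgt; apply/negP => bl; apply: gt; split => //; exact: ltW.
  apply: (@le_trans _ _ (hausdorff1 (gamma_ j @` A `|` sublevel S b l `\` K))).
    apply: le_outer_measure => _ [[t It <-] Kt].
    have [St|St] := pselect (sublevel S b l (gamma_ j t)); first by right.
    by left; exists t.
  rewrite (le_trans (outer_measureU2 _ _ _))// (le_trans (leeD gA SK))//.
  rewrite -EFinD lee_fin mulrDl mul1r lerD2r ler_pM2r ?invr_gt0// ler_pM2l//.
  exact: ler_norm.
have [gamma_cube gamma_lip] := gammaC.
apply: (@le_trans _ _ (hausdorff1 ((gamma @` unitI) `\` K))).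
  by apply: le_outer_measure; exact: setDS.
have := @hausdorff1_limit_path_le R n (fun j => gamma_ j \o clamp) (gamma \o clamp) K
  ((n.+1%:R * `|M| + 1) / l) _ _ _ cK.
rewrite image_clamp// => /(_ _ _ _ _)/le_trans; apply.
- by move=> j; apply: continuous_clamp C_gt0 _; exact: (gamma_C j).2.
- exact: continuous_clamp C_gt0 gamma_lip.
- move=> t It /=; rewrite clamp_id//.
  have tI : [set t] `<=` unitI by move=> _ ->.
  by move: gamma_cvg => /(uniform_subset_cvg _ tI); rewrite uniform_set1.
- by move=> j; rewrite image_clamp.
rewrite lee_fin mulrA ler_pdivrMr// [leRHS]mulrC -ler_pdivrMr// /l.
by rewrite lerDl.
Qed.
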